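(* Let $m$ and $n$ be distinct positive integers at most equal to $100$, and let $K$ be a field with $\operatorname{char}(K)=0$. Then the polynomials $f_m(X), f_n(X)\in K[X]$ satisfy the equality $\gcd\{f_m(X),f_n(X)\}=1$ if and only if $6\mid mn$.
   Context: For each positive integer $n$, $f_n(X)=(1+X)^n+(-1)^n(X^n+1)\in K[X]$. The notation $\gcd\{f_m(X),f_n(X)\}=1$ means that the two polynomials are relatively prime in $K[X]$.
   Formalization: The formal theorem requires m and n to be at least 2: f_1 is the zero polynomial, so gcd{f_1,f_6} = f_6 is not 1 although 6 divides 1·6, and the claim as stated fails when an index is 1. *)

(* Defs.v *)
From mathcomp Require Import all_boot all_order all_algebra.
Set Implicit Arguments.
Unset Strict Implicit.
Unset Printing Implicit Defensive.
Import GRing.Theory.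
Local Open Scope ring_scope.

(* [fpoly K 1] is the zero polynomial, so [coprimep (fpoly K 1) q] holds only
   when q is a nonzero constant. *)
Definition fpoly (K : fieldType) (n : nat) : {poly K} :=
  (1 + 'X) ^+ n + (-1) ^+ n * ('X^n + 1).

(* Main.v *)
(** With [Z := -(1 + X)] one has [fpoly K n = (-1)^n (X^n + 1 + Z^n)], a power sum
    of three quantities of sum zero.  If [m] and [n] are both odd, [X] divides
    both polynomials; if [3] divides neither, [X^2 + X + 1] does, because its
    roots make [1], [X], [Z] proportional to the three cube roots of unity.

    Conversely, Newton's identity writes [fpoly K n] as an integer polynomial
    [F_n] of degree at most [n / 2] in [X^2 + X + 1], so it suffices that [F_m]
    and [F_n] be coprime over the rationals.  By Gauss's lemma this can be
    tested modulo any prime that does not divide the leading coefficient of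
    [F_m]; for the pairs at hand one of 5, 7, 11, 13 always succeeds. *)
From Stdlib Require Import ZArith.
Require Import Defs.
From mathcomp Require Import all_boot all_order all_algebra.
From mathcomp Require Import ssrZ zify ring.
Set Implicit Arguments.
Unset Strict Implicit.
Unset Printing Implicit Defensive.
Import GRing.Theory.
Local Open Scope ring_scope.
(* [%Z] denotes [int] here. *)
Delimit Scope Z_scope with bZ.

(** * Coprimality transferred through integer polynomials *)

Lemma coprimep_common_dvd (K : fieldType) (d p q : {poly K}) :
  d %| p -> d %| q -> coprimep p q -> size d = 1%N.
Proof.
move=> dp dq cpq; apply/eqP; rewrite -coprimepp.
exact: coprimep_dvdl dq (coprimep_dvdr dp cpq).
Qed.

(** By Gauss's lemma the primitive part [d] of the gcd divides [p] and [q] over the integers. Its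
    leading coefficient divides that of [p], so its degree survives in [k] and [d] is constant. A
    Bezout relation over the integers then yields a nonzero integer, invertible in [K]. *)
Lemma coprimep_map_intr (k K : fieldType) (p q : {poly int}) :
  [pchar K] =i pred0 -> (lead_coef p)%:~R != 0 :> k ->
  coprimep (map_poly intr p : {poly k}) (map_poly intr q) ->
  coprimep (map_poly intr p : {poly K}) (map_poly intr q).
Proof.
move=> charK0 lp_neq0 cpq.
have [r Dp] := dvdpP_int (dvdp_gcdl p q).
have [s Dq] := dvdpP_int (dvdp_gcdr p q).
set d := zprimitive _ in Dp Dq.
have sz_d : size d = 1%N.
  have ld_neq0 : (lead_coef d)%:~R != 0 :> k.
    by apply: contraNneq lp_neq0 => ld0; rewrite Dp lead_coefM intrM ld0 mul0r.
  rewrite -(size_map_poly_id0 ld_neq0).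
  by apply: coprimep_common_dvd cpq; rewrite (Dp, Dq) rmorphM dvdp_mulr.
have /Bezout_coprimepP[[u v] /=] : coprimep p q.
  by rewrite /coprimep -size_zprimitive sz_d.
rewrite -size_poly_eq1 => /size_poly1P[c c_neq0 Dc].
apply/Bezout_coprimepP; exists (map_poly intr u, map_poly intr v) => /=.
rewrite -!rmorphM -rmorphD Dc /= map_polyC /= -size_poly_eq1 size_polyC.
suff -> : (c%:~R : K) != 0 by [].
have /pcharf0P natr0 := charK0.
by case: c c_neq0 {Dc} => n nz; rewrite ?NegzE ?rmorphN ?oppr_eq0 /= natr0.
Qed.

(** * Recurrence and common factors *)

Section FPoly.
Variable K : fieldType.

(** Newton's identity for [1], [X], [Z], whose elementary symmetric functions are 0, -(X^2 + X + 1)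
    and -(X^2 + X). *)
Lemma fpoly_rec n :
  fpoly K n.+3 = ('X^2 + 'X + 1) * fpoly K n.+1 + ('X^2 + 'X) * fpoly K n.
Proof. by rewrite /fpoly !exprS; ring. Qed.

Lemma dvdp_X_fpoly n : odd n -> 'X %| fpoly K n.
Proof.
move=> n_odd; rewrite -['X]subr0 -[0]/(0%:P) -root_factor_theorem rootE.
rewrite /fpoly -signr_odd n_odd !hornerE expr1n expr0n; case: n n_odd => //= n _.
by apply/eqP; ring.
Qed.

Lemma dvdp_cyclotomic3_fpoly n :
  ~~ (3 %| n)%N -> ('X^2 + 'X + 1 : {poly K}) %| fpoly K n.
Proof.
have [m] := ubnP n; elim: m n => // m IH [|[|[|n]]] //.
- by rewrite (_ : fpoly K 1 = 0) ?dvdp0 // /fpoly; ring.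
- by rewrite (_ : fpoly K 2 = 2 * ('X^2 + 'X + 1)) ?dvdp_mull // /fpoly; ring.
rewrite ltnS => n_lt n3.
have := IH n (leq_trans (leqnSn _) (leq_trans (leqnSn _) n_lt)).
(* Since X^2 + X is -1 modulo X^2 + X + 1, the recurrence becomes f_(n+3) = -f_n there. *)
rewrite (_ : fpoly K n.+3 =
  ('X^2 + 'X + 1) * (fpoly K n.+1 + fpoly K n) - fpoly K n); last first.
  by rewrite fpoly_rec; ring.
by rewrite dvdp_subr ?dvdp_mulr // => -> //; lia.
Qed.

End FPoly.

(** * Computation with integer coefficient lists *)

Fixpoint add_seq (s t : seq Z) : seq Z :=
  match s, t with
  | a :: s', b :: t' => (a + b)%bZ :: add_seq s' t'
  | [::], _ => t
  | _, [::] => s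
  end.

(** Prepending 0 multiplies by [T], so the new entry is T (F_n + F_(n+1)) - F_n. *)
Definition step_seq (u : seq Z * seq Z * seq Z) : seq Z * seq Z * seq Z :=
  let: (s0, s1, s2) := u in
  (s1, s2, add_seq (0%bZ :: add_seq s0 s1) (map Z.opp s0)).

(* Coefficients, constant term first, of the polynomial [F_n] with
   [F_(n+3) = T F_(n+1) + (T - 1) F_n]. *)
Definition newton_state (n : nat) : seq Z * seq Z * seq Z :=
  iter n step_seq ([:: 3%bZ], [::], [:: 0%bZ; 2%bZ]).

Definition newton_seq (n : nat) : seq Z := (newton_state n).1.1.

Section Elimination.
Variable p : Z.

Fixpoint elim_seq (a b : Z) (s t : seq Z) : seq Z :=
  match s, t with
  | x :: s', y :: t' => ((b * x - a * y) mod p)%bZ :: elim_seq a b s' t'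
  | [::], _ => [seq ((- a * y) mod p)%bZ | y <- t]
  | _, [::] => [seq ((b * x) mod p)%bZ | x <- s]
  end.

(* A Euclidean algorithm that cancels the constant terms and then divides by
   the indeterminate, which is prime to any polynomial with a nonzero constant
   term. *)
Fixpoint coprime_seq (k : nat) (s t : seq Z) : bool :=
  match k, s, t with
  | k'.+1, a :: s', b :: t' =>
    if (a mod p =? 0)%bZ then
      if (b mod p =? 0)%bZ then false else coprime_seq k' s' t
    else if (b mod p =? 0)%bZ then coprime_seq k' s t'
    else if nilp s' || nilp t' then true
    else if (size s' < size t')%N
         then coprime_seq k' s (elim_seq b a t' s')
         else coprime_seq k' (elim_seq a b s' t') t
  | _, _, _ => false
  end.

End Elimination.

(** Only [s] has to keep its degree modulo [q], as in [coprimep_map_intr]. Each step of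
    [coprime_seq] shortens the lists by one in total, so the fuel suffices. *)
Definition coprime_mod (q : nat) (s t : seq Z) : bool :=
  let p := Z.of_nat q in
  if (last 0 s mod p =? 0)%bZ then false
  else coprime_seq p (size s + size t) [seq (a mod p)%bZ | a <- s]
                                       [seq (b mod p)%bZ | b <- t].

(* The conditionals keep [vm_compute], which is call-by-value, from running
   the unneeded tests. *)
Fixpoint coprime_some_mod (qs : seq nat) (s t : seq Z) : bool :=
  if qs is q :: qs' then
    if coprime_mod q s t then true else coprime_some_mod qs' s t
  else false.

(** The indices run from 2 to [N + 1]; reducing them modulo 6 keeps the unary products small. *)
Definition all_coprime_mod (N : nat) (qs : seq nat) : bool :=
  let T := [seq (n, newton_seq n) | n <- iota 2 N] in
  all (fun u => all (fun v =>
    if [&& (u.1 < v.1)%N & (6 %| (u.1 %% 6) * (v.1 %% 6))%N]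
    then coprime_some_mod qs u.2 v.2 else true) T) T.

Lemma all_coprime_mod_99 : all_coprime_mod 99 [:: 5; 7; 11; 13]%N.
Proof. by vm_cast_no_check (erefl true). Qed.

(** * Polynomials given by coefficient lists *)

Definition seq_poly (R : nzRingType) (s : seq Z) : {poly R} :=
  foldr (fun a q => (int_of_Z a)%:~R%:P + 'X * q) 0 s.

Section SeqPoly.
Variable R : comNzRingType.
Implicit Types s t : seq Z.

Lemma seq_poly_add s t :
  seq_poly R (add_seq s t) = seq_poly R s + seq_poly R t.
Proof.
elim: s t => [|a s IH] [|b t] //=; rewrite ?add0r ?addr0 // IH.
rewrite (_ : int_of_Z (a + b)%bZ = int_of_Z a + int_of_Z b); last by lia.
by rewrite intrD polyCD; ring.
Qed.

Lemma seq_poly_opp s : seq_poly R (map Z.opp s) = - seq_poly R s.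
Proof.
elim: s => [|a s IH] /=; first by rewrite oppr0.
rewrite IH (_ : int_of_Z (- a)%bZ = - int_of_Z a); last by lia.
by rewrite rmorphN polyCN; ring.
Qed.

Lemma map_seq_poly s : map_poly intr (seq_poly int s) = seq_poly R s.
Proof.
elim: s => [|a s IH] /=; first by rewrite rmorph0.
by rewrite rmorphD rmorphM /= map_polyC map_polyX IH /= intz.
Qed.

Lemma size_seq_poly s : (size (seq_poly R s) <= size s)%N.
Proof.
elim: s => [|a s IH] /=; first by rewrite size_poly0.
rewrite addrC mulrC -cons_poly_def size_cons_poly.
by case: ifP.
Qed.

Lemma coef_last_seq_poly s :
  (seq_poly R s)`_(size s).-1 = (int_of_Z (last 0 s))%:~R.
Proof.
case: s => [|a s] /=; first by rewrite coef0.
elim: s a => [|b s IH] a /=; first by rewrite mulr0 addr0 coefC.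
by rewrite coefD coefC add0r coefXM /= IH.
Qed.
End SeqPoly.

Lemma lead_coef_seq_poly_int s : int_of_Z (last 0 s) != 0 ->
  lead_coef (seq_poly int s) = int_of_Z (last 0 s).
Proof.
move=> nz; have := coef_last_seq_poly int s; rewrite intz => lc.
rewrite -lc /lead_coef; congr _`__; congr _.-1; apply/eqP.
rewrite eqn_leq size_seq_poly /=; case: s nz lc => //= a s nz lc.
rewrite ltnNge; apply/negP => /leq_sizeP/(_ _ (leqnn _)); rewrite lc => /eqP.
by apply/negP.
Qed.

(** * Soundness of the elimination modulo a prime *)

Section Modular.
Variables (k : fieldType) (p : Z).
Hypothesis intr_eq0 : forall a : Z, ((int_of_Z a)%:~R == 0 :> k) = (a mod p =? 0)%bZ.

Lemma intr_mod (a : Z) : (int_of_Z (a mod p)%bZ)%:~R = (int_of_Z a)%:~R :> k.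
Proof.
apply/eqP; rewrite -subr_eq0 -intrB.
rewrite (_ : _ - _ = int_of_Z (a mod p - a)%bZ); last by lia.
by rewrite intr_eq0 Zminus_mod Zmod_mod Z.sub_diag Zmod_0_l.
Qed.

Lemma elim_seqE a b s t :
  seq_poly k (elim_seq p a b s t) =
    (int_of_Z b)%:~R *: seq_poly k s - (int_of_Z a)%:~R *: seq_poly k t.
Proof.
have intr_mul x y : int_of_Z (x * y)%bZ = int_of_Z x * int_of_Z y by nia.
have map_mulmod c u : seq_poly k [seq ((c * y) mod p)%bZ | y <- u] =
    (int_of_Z c)%:~R *: seq_poly k u.
  elim: u => [|y u IH] /=; first by rewrite scaler0.
  by rewrite IH intr_mod intr_mul intrM polyCM -!mul_polyC; ring.
elim: s t => [|x s IH] [|y t] /=.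
- by rewrite !scaler0 subr0.
- have /= -> := map_mulmod (- a)%bZ (y :: t); rewrite scaler0 sub0r -scaleNr -rmorphN.
  by congr (_%:~R *: _); lia.
- by have /= -> := map_mulmod b (x :: s); rewrite scaler0 subr0.
rewrite IH intr_mod (_ : int_of_Z _ = int_of_Z b * int_of_Z x - int_of_Z a * int_of_Z y).
  by rewrite intrB !intrM polyCB !polyCM -!mul_polyC; ring.
by rewrite -!intr_mul; lia.
Qed.

(** The elimination gives h with b f = a g + X h. Here [b] is a unit, and [X] is prime to g because
    g(0) = b. *)
Lemma coprimep_cons a b s t : (int_of_Z b)%:~R != 0 :> k ->
  coprimep (seq_poly k (a :: s)) (seq_poly k (b :: t)) =
  coprimep (seq_poly k (elim_seq p a b s t)) (seq_poly k (b :: t)).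
Proof.
move=> b_neq0; set f := seq_poly k (a :: s); set g := seq_poly k (b :: t).
have X_g : coprimep 'X g.
  by rewrite coprimep_sym coprimepX rootE !hornerE.
rewrite -(coprimepZl f g b_neq0) coprimep_sym.
have -> : (int_of_Z b)%:~R *: f =
    (int_of_Z a)%:~R%:P * g + 'X * seq_poly k (elim_seq p a b s t).
  by rewrite elim_seqE /f /g /= -!mul_polyC; ring.
by rewrite coprimep_addl_mul coprimepMr coprimep_sym X_g coprimep_sym.
Qed.

Lemma coprime_seqP n s t :
  coprime_seq p n s t -> coprimep (seq_poly k s) (seq_poly k t).
Proof.
have X_cons a s' : (a mod p =? 0)%bZ = false -> coprimep 'X (seq_poly k (a :: s')).
  by move=> a0; rewrite coprimep_sym coprimepX rootE !hornerE /= intr_eq0 a0.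
have coprime_cst a s' f : (a mod p =? 0)%bZ = false -> nilp s' ->
    coprimep (seq_poly k (a :: s')) f.
  move=> a0 /nilP->; rewrite /= mulr0 addr0 (@eqp_coprimepl _ _ _ 1) ?coprime1p //.
  by rewrite -size_poly_eq1 size_polyC intr_eq0 a0.
elim: n s t => [|n IH] [|a s] [|b t] //=.
case: ifPn => [a0|/negbTE a0]; case: ifPn => [b0|/negbTE b0] //.
- move=> /IH cst; move: a0; rewrite -intr_eq0 => /eqP->.
  by rewrite add0r coprimepMl cst (X_cons b t b0).
- move=> /IH cst; move: b0; rewrite -intr_eq0 => /eqP->.
  by rewrite add0r coprimepMr cst coprimep_sym (X_cons a s a0).
case: ifP => [/orP[s0|t0] _|_]; first exact: coprime_cst.
  by rewrite coprimep_sym; exact: coprime_cst.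
case: ifP => _ /IH cst.
  by rewrite coprimep_sym (coprimep_cons b t s) ?intr_eq0 ?a0 // coprimep_sym.
by rewrite (coprimep_cons a s t) ?intr_eq0 ?b0.
Qed.
End Modular.

(** The test gives coprimality over ['F_q]; the polynomials over ['F_q] and over [K] are images of
    the same integer ones, so [coprimep_map_intr] applies. *)
Lemma coprime_modP (K : fieldType) (charK0 : [pchar K] =i pred0) q s t :
  prime q -> coprime_mod q s t -> coprimep (seq_poly K s) (seq_poly K t).
Proof.
move=> q_prime; rewrite /coprime_mod; case: ifPn => // ls_neq0.
have intr_eq0 a : ((int_of_Z a)%:~R == 0 :> 'F_q) = (a mod (Z.of_nat q) =? 0)%bZ.
  rewrite -(dvdz_pcharf (pchar_Fp q_prime)).
  apply/idP/idP => [/dvdzP[z az]|/Z.eqb_eq a_mod0].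
    by apply/Z.eqb_eq/Z.mod_divide; [move: (prime_gt0 q_prime); lia | exists (Z_of_int z); lia].
  apply/dvdzP; exists (int_of_Z (a / Z.of_nat q)%bZ).
  have := Z.div_mod a (Z.of_nat q); rewrite a_mod0; move: (prime_gt0 q_prime); nia.
have map_mod s' : seq_poly 'F_q [seq (a mod Z.of_nat q)%bZ | a <- s'] = seq_poly 'F_q s'.
  by elim: s' => //= a s' ->; rewrite (intr_mod intr_eq0).
move=> /(coprime_seqP intr_eq0); rewrite !map_mod -!(map_seq_poly 'F_q) -!(map_seq_poly K).
apply: coprimep_map_intr => //; rewrite lead_coef_seq_poly_int ?intr_eq0 //.
by apply: contraNneq ls_neq0 => ls0; rewrite -intr_eq0 ls0.
Qed.

(** * Composition with X^2 + X + 1 and the equivalence *)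

#[local] Arguments add_seq : simpl never.

(** With T = X^2 + X + 1 one has X^2 + X = T - 1, so [fpoly_rec] is the recurrence of
    [newton_state]; its order makes the induction carry three consecutive indices. *)
Lemma fpolyE (K : fieldType) n :
  fpoly K n = seq_poly K (newton_seq n) \Po ('X^2 + 'X + 1).
Proof.
pose F s := seq_poly K s \Po ('X^2 + 'X + 1).
suff [] : [/\ F (newton_state n).1.1 = fpoly K n,
              F (newton_state n).1.2 = fpoly K n.+1 &
              F (newton_state n).2 = fpoly K n.+2] by [].
elim: n => [|n]; rewrite /newton_state /F.
  rewrite /= !(comp_polyD, comp_polyM, comp_polyC, comp_polyX, comp_poly0) /fpoly.
  rewrite (_ : Pos.to_nat 3 = 3%N) // (_ : Pos.to_nat 2 = 2%N) // !(rmorph_int (@polyC K)).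
  by split; ring.
rewrite iterS; case: (iter n _ _) => [[s0 s1] s2] /= [IH0 IH1 IH2].
split => //; rewrite seq_poly_add seq_poly_opp /= seq_poly_add.
rewrite !(comp_polyD, comp_polyM, comp_polyC, comp_polyX, raddfN) /= IH0 IH1 fpoly_rec.
ring.
Qed.

Lemma coprimep_fpoly (K : fieldType) (charK0 : [pchar K] =i pred0) (m n : nat) :
  (1 < m < n)%N -> (n <= 100)%N -> (6 %| m * n)%N ->
  coprimep (fpoly K m) (fpoly K n).
Proof.
move=> /andP[m_gt1 lt_mn] n_le100 dv6.
(* A Bezout relation between F_m and F_n survives composition. *)
rewrite !fpolyE; apply: coprimep_comp_poly.
have /allP/(_ (m, newton_seq m)) := all_coprime_mod_99.
rewrite map_f ?mem_iota; last by lia.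
move=> /(_ isT)/allP/(_ (n, newton_seq n)).
rewrite map_f ?mem_iota; last by lia.
move=> /(_ isT); case: ifPn => [_|/negP[]]; last first.
  by apply/andP; split; rewrite //= /dvdn modnMm.
have : all prime [:: 5; 7; 11; 13]%N by [].
elim: [:: _; _; _; _] => //= q qs IH /andP[q_prime /IH{}IH].
by case: ifP => [/(coprime_modP charK0 q_prime)|].
Qed.

(** Index 1 is excluded: [fpoly K 1] is 0, hence not coprime to the nonconstant [fpoly K 6],
    although 6 divides 1 * 6. *)
Theorem theorem1p1 (K : fieldType) (charK0 : [pchar K] =i pred0) (m n : nat)
    (m_gt1 : (1 < m)%N) (n_gt1 : (1 < n)%N)
    (m_le100 : (m <= 100)%N) (n_le100 : (n <= 100)%N) (neq_mn : m <> n) :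
  coprimep (fpoly K m) (fpoly K n) <-> (6 %| m * n)%N.
Proof.
split=> [cmn|dv6]; last first.
  have [lt_mn|lt_nm|//] := ltngtP m n.
    by apply: coprimep_fpoly; rewrite ?m_gt1.
  by rewrite coprimep_sym; apply: coprimep_fpoly; rewrite ?n_gt1 // mulnC.
rewrite (@Gauss_dvd 2 3) //; apply/andP; split.
  rewrite dvdn2 oddM; apply/negP => /andP[m_odd n_odd].
  have := coprimep_common_dvd (dvdp_X_fpoly K m_odd) (dvdp_X_fpoly K n_odd) cmn.
  by rewrite size_polyX.
rewrite Euclid_dvdM //; apply/norP => [[m3 n3]].
have := coprimep_common_dvd (dvdp_cyclotomic3_fpoly K m3) (dvdp_cyclotomic3_fpoly K n3) cmn.
by rewrite -addrA size_polyDl ?size_polyXn // size_XaddC.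
Qed.
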